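(* The modes of $Q_n(x)$ are located around $\mu_n$. Let $m_n$ be a mode of $Q_n(x)$. Then $$0<\left|\frac{2}{5}\left(\frac{F_{2n+1}}{F_{2n}}-\frac12+\frac1n\right)n-m_n\right|<1 .$$
   Context: Here $n\in\mathbb{N}=\{1,2,\dots\}$. The polynomials $Q_n(x)$ are defined by $Q_0(x)=1$ and $Q_n(x)=x\sum_{k=1}^n k\,Q_{n-k}(x)$ for $n\ge 1$. The numbers $A_{n,k}$ are their coefficients: $Q_n(x)=\sum_{k=0}^n A_{n,k}x^k$. For $n\ge1$ and $0\le k\le n$ one has $A_{n,k}=\binom{n+k-1}{2k-1}$, with $A_{n,0}=0$. A mode of $Q_n(x)$ is an index $m\in\{0,\dots,n\}$ with $A_{n,m}=\max_{0\le k\le n}A_{n,k}$. $F_n$ denotes the Fibonacci numbers, $F_0=0$, $F_1=1$, $F_n=F_{n-1}+F_{n-2}$. The number $\mu_n$ is the expected value of the random variable $X_n\in\{0,1,\dots,n\}$ with distribution $P(X_n=k)=A_{n,k}/\sum_{m=0}^n A_{n,m}$; it is given by $\mu_n=\frac{2}{5}\left(\frac{F_{2n+1}}{F_{2n}}-\frac12+\frac1n\right)n$.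
   Formalization: The strict lower bound 0 < |...| is asserted only for n ≥ 2, since for n = 1 one has Q_1(x) = x, m_1 = 1 and the displayed mean equals 1, so the difference is 0; the upper bound < 1 is kept for all n ≥ 1. *)

(* Defs.v *)
From mathcomp Require Import all_boot all_order all_algebra.

Set Implicit Arguments.
Unset Strict Implicit.
Unset Printing Implicit Defensive.

Import Order.TTheory GRing.Theory Num.Theory.
Local Open Scope ring_scope.

Fixpoint fib (n : nat) : nat :=
  if n is n1.+1 then
    if n1 is n2.+1 then (fib n1 + fib n2)%N else 1%N
  else 0%N.

(* The course-of-values recursion defining Q is run on the list
   [:: Q_n; ...; Q_0]; lemmas Q_0 and Q_rec below recover the usual form. *)
Fixpoint Q_list (R : realFieldType) (n : nat) : seq {poly R} :=
  if n is n1.+1 then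
    ('X * \sum_(k < n1.+1) k.+1%:R *: (Q_list R n1)`_k) :: Q_list R n1
  else [:: 1].

Definition Q (R : realFieldType) (n : nat) : {poly R} := (Q_list R n)`_0.

Definition A (R : realFieldType) (n k : nat) : R := (Q R n)`_k.

Definition is_mode (R : realFieldType) (n m : nat) : Prop :=
  (m <= n)%N /\ forall k : nat, (k <= n)%N -> A R n k <= A R n m.

Lemma Q_list_nth (R : realFieldType) (n k : nat) :
  (k <= n)%N -> (Q_list R n)`_k = Q R (n - k).
Proof.
elim: n k => [|n IHn] [|k] //= le_kn.
by rewrite IHn // subSS.
Qed.

Lemma Q_0 (R : realFieldType) : Q R 0 = 1.
Proof. by []. Qed.

Lemma Q_rec (R : realFieldType) (n : nat) : (1 <= n)%N ->
  Q R n = 'X * \sum_(1 <= k < n.+1) k%:R *: Q R (n - k).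
Proof.
case: n => // n _; rewrite big_add1 /= big_mkord /Q /=; congr ('X * _).
apply: eq_bigr => k _; rewrite Q_list_nth; last by rewrite -ltnS.
by rewrite subSS.
Qed.

(* Main.v *)
Require Import Defs.
From mathcomp Require Import all_boot all_order all_algebra.
From mathcomp Require Import zify ring lra.

Set Implicit Arguments.
Unset Strict Implicit.
Unset Printing Implicit Defensive.

Import Order.TTheory GRing.Theory Num.Theory.
Local Open Scope ring_scope.

(** Write [mu] for the mean, [F = fib (2n)], [G = fib (2n+1)] and
    [L = 2G - F] (a Lucas number), so that [5 mu = n L / F + 2].

    The coefficients of [Q n] are [A n k = 'C(n+k-1, 2k-1)], and consecutive
    ones have the ratio [(n^2 - k^2) / (2k (2k+1))]. Hence [A n k <= A n k.+1]
    exactly when [5k^2 + 2k <= n^2], which confines a mode [m] by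
    [5(m-1)^2 + 2(m-1) <= n^2 <= 5m^2 + 2m] (lemma [mode_bounds]). On the other
    side, Cassini's identity reads [L^2 = 5F^2 + 4]; with [n <= F] it gives
    [5n^2 < (n L / F)^2 <= 5n^2 + 4]. Comparing squares, the two estimates give
    [5m - 7 < n L / F < 5m + 3], which is [m - 1 < mu < m + 1]; for [m = 1] the
    lower bound is negative and holds because [L > 0].

    If [mu] were equal to the integer [m], then clearing denominators would
    show that [F] divides [2 n G], hence [2n], since consecutive Fibonacci
    numbers are coprime. But [F > 2n] for [n >= 3], and [F = 3] does not divide
    [4] for [n = 2]. *)

(** * Coefficients of Q *)

(** Subtracting the recursions for [Q n.+1] and [Q n] lowers every weight by
    one. For [n = 0] this breaks down, since [Q 0] is an initial value that
    does not come from the recursion. *)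
Lemma Q_step (R : realFieldType) (n : nat) : (1 <= n)%N ->
  Q R n.+1 = Q R n + 'X * \sum_(0 <= j < n.+1) Q R j.
Proof.
move=> n1; rewrite (Q_rec R n1) Q_rec // -mulrDr; congr (_ * _).
have -> : \sum_(1 <= k < n.+1) k%:R *: Q R (n - k)
        = \sum_(0 <= k < n.+1) k%:R *: Q R (n - k).
  by rewrite [RHS]big_nat_recl // scale0r add0r big_add1.
rewrite big_add1 /= [X in _ = _ + X]big_nat_rev /=.
rewrite -big_split /=; apply: eq_bigr => k _.
by rewrite add0n !subSS -natr1 scalerDl scale1r.
Qed.

Lemma A_n0 (R : realFieldType) (n : nat) : A R n.+1 0 = 0.
Proof. by rewrite /A Q_rec // coefXM. Qed.

Lemma A_step (R : realFieldType) (n k : nat) :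
  A R n.+2 k.+1 = A R n.+1 k.+1 + \sum_(0 <= j < n.+2) A R j k.
Proof. by rewrite /A Q_step // coefD coefXM /= coef_sum. Qed.

(** The partial sums are binomial coefficients as well; proving both formulas
    together makes each induction step an instance of Pascal's rule. *)
Lemma A_binomial_and_sum (R : realFieldType) (n : nat) :
  (forall k, A R n.+1 k.+1 = 'C(n + k.+1, k.*2.+1)%:R) /\
  (forall k, \sum_(0 <= j < n.+1) A R j k = 'C(n + k, k.*2)%:R).
Proof.
elim: n => [|n [IHA IHS]].
  have S0 k : A R 0 k = 'C(k, k.*2)%:R.
    rewrite /A Q_0 coef1; case: k => [|k] //=.
    by rewrite bin_small // -addnn; lia.
  split=> k; last by rewrite big_nat1 S0.
  have -> : A R 1 k.+1 = A R 0 k.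
    by rewrite /A Q_rec // big_nat1 scale1r coefXM.
  rewrite S0; case: k => [|k] //.
  by rewrite !bin_small //; lia.
have IHS' k : \sum_(0 <= j < n.+2) A R j k = 'C(n.+1 + k, k.*2)%:R.
  rewrite big_nat_recr //= IHS; case: k => [|k].
    by rewrite A_n0 addr0 !bin0.
  by rewrite IHA doubleS addSn binS natrD.
split=> // k.
by rewrite A_step IHA IHS' -natrD !addnS !addSn -binS.
Qed.

Lemma A_binomial (R : realFieldType) (n k : nat) :
  A R n.+1 k.+1 = 'C(n + k.+1, k.*2.+1)%:R.
Proof. by have [-> _] := A_binomial_and_sum R n. Qed.

(** * Location of the mode *)

Lemma binomial_ratio (n k : nat) : (k <= n)%N ->
  ('C(n + k.+2, k.*2.+3) * (k.*2.+3 * k.*2.+2) =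
   'C(n + k.+1, k.*2.+1) * ((n + k.+2) * (n - k)))%N.
Proof.
move=> kn.
have e1 := mul_bin_diag (n + k.+2) k.*2.+2.
have e2 := mul_bin_left (n + k.+1) k.*2.+1.
have e3 : (n + k.+1 - k.*2.+1 = n - k)%N by lia.
rewrite e3 in e2; rewrite addnS /= -addnS in e1.
rewrite mulnA [('C(n + k.+2, _) * _)%N]mulnC -e1.
by rewrite -mulnA [('C(_, _) * _.+2)%N]mulnC e2; ring.
Qed.

(** The ratio of the two coefficients compares with 1 as [n^2 - k^2] does with
    [2k (2k+1)], which is where [5k^2 + 2k] comes from. *)
Lemma A_leS (R : realFieldType) (n k : nat) : (1 <= k <= n)%N ->
  (A R n k <= A R n k.+1) = (5 * k ^ 2 + 2 * k <= n ^ 2)%N.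
Proof.
case: n => [|n]; first by case: k.
case: k => [|k] //= kn; rewrite !A_binomial ler_nat doubleS.
have c_gt0 : (0 < 'C(n + k.+1, k.*2.+1))%N by rewrite bin_gt0; lia.
rewrite -(@leq_pmul2r (k.*2.+3 * k.*2.+2)) // binomial_ratio //.
rewrite leq_pmul2l //; nia.
Qed.

Lemma A_geS (R : realFieldType) (n k : nat) : (1 <= k <= n)%N ->
  (A R n k.+1 <= A R n k) = (n ^ 2 <= 5 * k ^ 2 + 2 * k)%N.
Proof.
case: n => [|n]; first by case: k.
case: k => [|k] //= kn; rewrite !A_binomial ler_nat doubleS.
have c_gt0 : (0 < 'C(n + k.+1, k.*2.+1))%N by rewrite bin_gt0; lia.
rewrite -(@leq_pmul2r (k.*2.+3 * k.*2.+2)) // binomial_ratio //.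
rewrite leq_pmul2l //; nia.
Qed.

Lemma mode_gt0 (R : realFieldType) (n m : nat) :
  (1 <= n)%N -> is_mode R n m -> (0 < m)%N.
Proof.
case: n => // n _ [_ /(_ 1%N isT)]; case: m => //.
by rewrite A_n0 A_binomial bin1 lern0 addn1.
Qed.

Lemma mode_bounds (R : realFieldType) (n m : nat) :
  (1 <= n)%N -> is_mode R n m ->
  (5 * m.-1 ^ 2 + 2 * m.-1 <= n ^ 2 <= 5 * m ^ 2 + 2 * m)%N.
Proof.
move=> n1 hm; have m0 := mode_gt0 n1 hm; case: hm => mn hmax.
apply/andP; split.
  case: m m0 mn hmax => [|[|m]] // _ mn hmax.
  by rewrite /= -(A_leS R) ?hmax //=; lia.
(* For [m = n] there is no next coefficient, but then the bound is trivial. *)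
have [<-|nm] := eqVneq m n; first nia.
by rewrite -(A_geS R) ?m0 ?hmax //; lia.
Qed.

(** * Fibonacci numbers *)

Lemma fibSS (n : nat) : fib n.+2 = (fib n.+1 + fib n)%N.
Proof. by []. Qed.

Lemma fib_cassini (n : nat) :
  (fib (2 * n + 1) ^ 2 =
   fib (2 * n + 1) * fib (2 * n) + fib (2 * n) ^ 2 + 1)%N.
Proof.
elim: n => // n IHn.
have -> : (2 * n.+1 = (2 * n).+2)%N by lia.
move: IHn; rewrite !addn1 !fibSS.
move: (fib (2 * n).+1) (fib (2 * n)) => x y e.
nia.
Qed.

Lemma coprime_fibS (n : nat) : coprime (fib n) (fib n.+1).
Proof.
elim: n => // n IHn.
by rewrite fibSS /coprime gcdnDl gcdnC.
Qed.

Lemma fib_gt0 (n : nat) : (0 < fib n.+1)%N.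
Proof. by elim: n => // n IHn; rewrite fibSS addn_gt0 IHn. Qed.

Lemma fib_double_ge (n : nat) : (n <= fib (2 * n))%N.
Proof.
elim: n => // n IHn.
have -> : (2 * n.+1 = (2 * n).+2)%N by lia.
by rewrite fibSS; have := fib_gt0 (2 * n); lia.
Qed.

Lemma fib_double_gt (n : nat) : (2 < n)%N -> (2 * n < fib (2 * n))%N.
Proof.
elim: n => // n IHn n2.
have [<-|n3] := eqVneq 2 n; first by [].
have {}IHn : (2 * n < fib (2 * n))%N by apply: IHn; lia.
have -> : (2 * n.+1 = (2 * n).+2)%N by lia.
case: n n2 n3 IHn => // n n2 n3 IHn.
have e : (2 * n.+1 = (2 * n).+2)%N by lia.
rewrite e in IHn *; rewrite !fibSS in IHn *.
by have := fib_gt0 (2 * n); lia.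
Qed.

Lemma fib_double_ndvd (n : nat) : (1 < n)%N -> ~~ (fib (2 * n) %| 2 * n)%N.
Proof.
move=> n1; have [<-|n2] := eqVneq 2 n; first by [].
by apply/negP => /dvdn_leq; have := @fib_double_gt n; lia.
Qed.

(** * The mean against an integer *)

(** The excluded equality is [mu = m] multiplied by [5F], with [nF] moved to
    the right so that no subtraction occurs. Modulo [F] it becomes
    [2 n G = 0]. *)
Lemma mean_neq_nat (n m : nat) : (1 < n)%N ->
  (2 * n * fib (2 * n + 1) + 2 * fib (2 * n)
   != (5 * m + n) * fib (2 * n))%N.
Proof.
move=> n1; apply: contraNneq (fib_double_ndvd n1); rewrite addn1 => e.
rewrite -(Gauss_dvdl _ (coprime_fibS (2 * n))).
by rewrite -(dvdn_addl _ (dvdn_mull 2 (dvdnn _))) e dvdn_mull.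
Qed.

(** All numbers are scaled by [F = f], so that no division occurs; [g] is
    [fib (2n+1)] and [2g - f] the Lucas number. *)
Lemma scaled_mean_bounds (R : realFieldType) (n m f g : nat) :
  (0 < m)%N -> (0 < f)%N -> (n <= f)%N -> (g ^ 2 = g * f + f ^ 2 + 1)%N ->
  (5 * m.-1 ^ 2 + 2 * m.-1 <= n ^ 2 <= 5 * m ^ 2 + 2 * m)%N ->
  (5 * m%:R - 7) * f%:R < n%:R * (2 * g%:R - f%:R) :> R /\
  n%:R * (2 * g%:R - f%:R) < (5 * m%:R + 3) * f%:R :> R.
Proof.
move=> m0 f0 nf cas /andP[lo hi].
have fg : (f < g)%N by nia.
have {cas}L2 : (2 * g%:R - f%:R) ^+ 2 = 5 * f%:R ^+ 2 + 4 :> R.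
  have : (g ^ 2)%:R = (g * f + f ^ 2 + 1)%:R :> R by rewrite cas.
  by rewrite !natrD !natrX natrM; lra.
have L0 : 0 < 2 * g%:R - f%:R :> R.
  have : f%:R < g%:R :> R by rewrite ltr_nat.
  have : 0 < f%:R :> R by rewrite ltr0n.
  by lra.
have f20 : 0 < f%:R ^+ 2 :> R by rewrite exprn_gt0 ?ltr0n.
have {}hi : n%:R ^+ 2 <= 5 * m%:R ^+ 2 + 2 * m%:R :> R.
  by rewrite -!natrX -!natrM -natrD ler_nat.
have nL0 : 0 <= n%:R * (2 * g%:R - f%:R) :> R by rewrite mulr_ge0 // ltW.
have nL2 : (n%:R * (2 * g%:R - f%:R)) ^+ 2
         = 5 * n%:R ^+ 2 * f%:R ^+ 2 + 4 * n%:R ^+ 2 :> R.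
  by rewrite exprMn L2; ring.
split; last first.
  have n2f2 : n%:R ^+ 2 <= f%:R ^+ 2 :> R by rewrite -!natrX ler_nat leq_sqr.
  have up0 : 0 <= (5 * m%:R + 3) * f%:R :> R.
    by rewrite mulr_ge0 // addr_ge0 ?mulr_ge0.
  rewrite -(ltr_pXn2r (n := 2)) // nL2 exprMn.
  apply: (@le_lt_trans _ _ ((5 * n%:R ^+ 2 + 4) * f%:R ^+ 2)); first by lra.
  rewrite ltr_pM2r //.
  have : 0 <= m%:R :> R by [].
  by lra.
(* Squares can only be compared once [5m - 7] is nonnegative. *)
have [m1|m2] := leqP m 1.
  apply: lt_le_trans nL0; rewrite pmulr_llt0 ?ltr0n //.
  have : m%:R <= 1 :> R by rewrite lern1.
  by lra.
have lowR : 5 * (m%:R - 1) ^+ 2 + 2 * (m%:R - 1) <= n%:R ^+ 2 :> R.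
  have -> : m%:R - 1 = m.-1%:R :> R by rewrite -subn1 natrB.
  by rewrite -!natrX -!natrM -natrD ler_nat.
have m2R : 2 <= m%:R :> R by rewrite ler_nat.
have low0 : 0 <= (5 * m%:R - 7) * f%:R :> R.
  by rewrite mulr_ge0 //; lra.
rewrite -(ltr_pXn2r (n := 2)) // nL2 exprMn.
apply: (@lt_le_trans _ _ (5 * n%:R ^+ 2 * f%:R ^+ 2)).
  by rewrite ltr_pM2r //; lra.
by rewrite lerDl mulr_ge0 // exprn_ge0.
Qed.

Theorem corollary1p5 (R : realFieldType) (n m : nat) (hn : (1 <= n)%N)
    (hm : is_mode R n m) :
  let d : R :=
    `| 2 / 5 * ((fib (2 * n + 1))%:R / (fib (2 * n))%:R - 1 / 2 + 1 / n%:R)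
         * n%:R - m%:R | in
  ((1 < n)%N -> 0 < d) /\ d < 1.
Proof.
have f_gt0 : (0 < fib (2 * n))%N by have := fib_double_ge n; lia.
have := scaled_mean_bounds R (mode_gt0 hn hm) f_gt0 (fib_double_ge n)
          (fib_cassini n) (mode_bounds hn hm).
have := @mean_neq_nat n m.
move: (fib (2 * n)) (fib (2 * n + 1)) f_gt0 => f g f_gt0 neq [lo hi] /=.
have f0 : 0 < f%:R :> R by rewrite ltr0n.
have n0 : 0 < n%:R :> R by rewrite ltr0n.
have -> : 2 / 5 * (g%:R / f%:R - 1 / 2 + 1 / n%:R) * n%:R - m%:R
  = (n%:R * (2 * g%:R - f%:R) - (5 * m%:R - 2) * f%:R) / (5 * f%:R) :> R.
  by field; rewrite !gt_eqF.
split=> [n1|].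
  rewrite normr_gt0 mulf_neq0 //; last by rewrite invr_eq0 mulf_neq0 ?gt_eqF.
  have := neq n1; rewrite -(eqr_nat R).
  apply: contraNN => /eqP e; apply/eqP.
  by rewrite !(natrD, natrM); lra.
rewrite ltr_norml ltr_pdivlMr ?ltr_pdivrMr ?mulr_gt0 //.
by apply/andP; split; lra.
Qed.
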